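(* Let $0<k<n$ and let $\lambda \vdash n$. Let $\mu_1, \ldots, \mu_q$ be the (distinct) partitions of $n-1$ whose Ferrers diagrams are exactly those obtained from the Ferrers diagram of $\lambda$ by removing one box from the right-hand end of a row so that the resulting diagram is still the diagram of a partition of $n-1$. Then $$\eta_{\lambda} (k) = \frac{n}{k f^\lambda} \sum_{j=1}^q f^{\mu_j} \eta_{\mu_j} (k-1),$$ where $\eta_\lambda(k)$ is the eigenvalue of $\mathcal{F}(n,k)$ indexed by $\lambda$ and $\eta_{\mu_j}(k-1)$ is the eigenvalue of $\mathcal{F}(n-1,k-1)$ indexed by $\mu_j$.
   Context: $\mathcal{S}_n$ is the symmetric group on $[n]=\{1,\dots,n\}$. For $0\le k<n$, $\mathcal{S}(n,k)$ is the set of all $\sigma\in\mathcal{S}_n$ fixing exactly $k$ points. The $k$-point fixing graph $\mathcal{F}(n,k)$ is the Cayley graph $\Gamma(\mathcal{S}_n,\mathcal{S}(n,k))$: its vertex set is $\mathcal{S}_n$, and $g,h$ are adjacent iff $gh^{-1}$ fixes exactly $k$ points. For $\lambda\vdash n$, let $\chi_\lambda$ be the irreducible (complex) character of $\mathcal{S}_n$ indexed by $\lambda$ in the standard way (so $\chi_{(n)}$ is the trivial character), and let $f^\lambda=\chi_\lambda(1)$ be its dimension. Since $\mathcal{S}(n,k)$ is closed under conjugation, the eigenvalues of $\mathcal{F}(n,k)$ are indexed by partitions $\lambda\vdash n$ and are the integers $$\eta_\lambda(k)=\frac{1}{f^\lambda}\sum_{\sigma\in\mathcal{S}(n,k)}\chi_\lambda(\sigma)$$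 (an empty sum being $0$). *)

(* Defs.v *)
From HB Require Import structures.
From mathcomp Require Import all_boot all_order all_algebra all_fingroup.
From mathcomp Require Import all_solvable all_field all_character.

Set Implicit Arguments.
Unset Strict Implicit.
Unset Printing Implicit Defensive.

Import Order.TTheory GRing.Theory Num.Theory.
Local Open Scope ring_scope.

(* The points 1, ..., n are the elements of 'I_n, and the
   complex characters take values in algC, as in MathComp's character theory. *)

Definition is_intpart (n : nat) (la : seq nat) : bool :=
  [&& sorted geq la, 0%N \notin la & sumn la == n].

Record intpart (n : nat) : Type :=
  IntPart { parts :> seq nat; _ : is_intpart n parts }.

HB.instance Definition _ n := [isSub for @parts n].
HB.instance Definition _ n := [Equality of intpart n by <:].

(* Boxes are pairs (row, column), both counted from 0. *)
Definition ferrers (la : seq nat) : pred (nat * nat) :=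
  [pred b | (b.2 < nth 0 la b.1)%N].

(* That the smaller diagram is again that of a partition is not required here:
   it is carried by the type [intpart m]. *)
Definition removes_box (n m : nat) (la : intpart n) (mu : intpart m) : Prop :=
  exists2 r : nat, (r < size la)%N &
    forall b : nat * nat,
      ferrers mu b = ferrers la b && (b != (r, (nth 0%N la r).-1)).

(* The canonical Young tableau of shape la places 0, 1, ..., n-1 in the boxes
   row after row: the entry i lies in row [reshape_index la i] and column
   [reshape_offset la i]. *)
Definition row_stab (n : nat) (la : intpart n) : {set 'S_n} :=
  [set s : 'S_n | [forall i : 'I_n,
     reshape_index la (s i) == reshape_index la i]].

Definition col_stab (n : nat) (la : intpart n) : {set 'S_n} :=
  [set s : 'S_n | [forall i : 'I_n,
     reshape_offset la (s i) == reshape_offset la i]].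

(* The Young symmetrizer sum_{p in R, q in C} sgn(q) p q, as a row vector
   indexed by the elements of the group. *)
Definition young_symmetrizer (n : nat) (la : intpart n)
    : 'rV[algC]_#|[set: 'S_n]%G| :=
  \sum_(p in row_stab la) \sum_(q in col_stab la)
     (-1) ^+ odd_perm q *: delta_mx 0 (gring_index [set: 'S_n]%G (p * q)%g).

(* The Specht module is the submodule of the regular module generated by the
   Young symmetrizer.  MathComp's regular module acts by right multiplication,
   so this is a right ideal c.A of the group algebra A; its character agrees
   with that of the left ideal A.c. *)
Definition specht_mx (n : nat) (la : intpart n) :=
  cyclic_mx (regular_repr algC [set: 'S_n]%G) (young_symmetrizer la).

Definition specht_repr (n : nat) (la : intpart n) :=
  submod_repr (cyclic_mx_module (regular_repr algC [set: 'S_n]%G)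
                                (young_symmetrizer la)).

(* This indexing makes the one-row partition correspond to the trivial
   character and the one-column partition to the sign character. *)
Definition chi (n : nat) (la : intpart n) : 'CF([set: 'S_n]) :=
  cfRepr (specht_repr la).

Definition dimf (n : nat) (la : intpart n) : algC := chi la 1%g.

Definition fixing_set (n k : nat) : {set 'S_n} :=
  [set s : 'S_n | #|[set i : 'I_n | s i == i]| == k].

(* The eigenvalue, indexed by la, of the Cayley graph of 'S_n with connection
   set [fixing_set n k] (g and h adjacent iff g * h^-1 fixes exactly k points);
   the formula is the usual one for a connection set that is a union of
   conjugacy classes. *)
Definition eta (n : nat) (la : intpart n) (k : nat) : algC :=
  (dimf la)^-1 * \sum_(s in fixing_set n k) chi la s.

(* Main.v *)
Require Import Defs.
From mathcomp Require Import all_boot all_order all_algebra all_fingroup.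
From mathcomp Require Import all_solvable all_field all_character.
From mathcomp Require Import ring zify.
Import Order.TTheory GRing.Theory Num.Theory.
Set Implicit Arguments.
Unset Strict Implicit.
Unset Printing Implicit Defensive.
Local Open Scope ring_scope.

(* Counting pairs (x, i) with x in S(n,k) and x i = i gives
     k * sum_(x in S(n,k)) chi_la(x) = n * sum_(s in S(n-1,k-1)) (Res chi_la)(s),
   so the theorem follows from the branching rule Res chi_la = sum_j chi_(mu_j).

   The Specht character of la is a constituent both of the character induced
   from the trivial character of the row stabiliser and of the one induced from
   the sign of the column stabiliser.  By von Neumann's lemma on tableaux the
   former for la and the latter for mu have inner product 1 if la = mu, and 0
   unless la is dominated by mu; hence Specht characters are irreducible and pairwise
   distinct.

   If mu is la minus a box, then keeping only the permutations that put n into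
   that box sends a translate of the Young symmetrizer of la to that of mu, so
   chi_mu occurs in Res chi_la.  The restriction of Ind chi_mu to S_n is
   (1 + Fix) chi_mu, where Fix counts fixed points, and <chi_mu, Fix chi_mu> is
   the norm of Res chi_mu; by induction the norm of Ind chi_mu is one plus the
   number of removable boxes of mu, that is, the number of addable ones.  Each
   addable box contributes a constituent, so there are no others. *)

(** * Multiplicities as ranks *)

(** In a rank factorisation of [P], idempotence makes the product of the two factors in reverse
    order the identity of size [\rank P]; the trace is the same in both orders. *)
Lemma mxtrace_idempotent (F : fieldType) n (P : 'M[F]_n) :
  P *m P = P -> \tr P = (\rank P)%:R.
Proof.
move=> PP; rewrite -{1}(mulmx_base P) mxtrace_mulC.
suff -> : row_base P *m col_base P = 1%:M by rewrite mxtrace1.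
have /row_fullP[L L1] := col_base_full P.
apply: (row_free_inj (row_base_free P)) => /=.
have LP : L *m P = row_base P by rewrite -[X in L *m X]mulmx_base mulmxA L1 mul1mx.
by rewrite mul1mx -mulmxA mulmx_base -LP -mulmxA PP.
Qed.

Section RepresentationRank.

Variables (gT : finGroupType) (G : {group gT}).

Let e (i : Iirr G) := Wedderburn_id (socle_of_Iirr i).

Lemma gring_op_intertwine n1 n2 (r1 : mx_representation algC G n1)
    (r2 : mx_representation algC G n2) (B : 'M_(n1, n2)) M :
    {in G, forall g, r1 g *m B = B *m r2 g} ->
  gring_op r1 M *m B = B *m gring_op r2 M.
Proof.
move=> com; rewrite !gring_opE /gring_mx /= ![gring_row M *m _]mulmx_sum_row.
rewrite !linear_sum /= mulmx_suml; apply: eq_bigr => i _.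
rewrite !linearZ /= !rowK !mxvecK -scalemxAl com ?enum_valP //.
Qed.

(** The central idempotent [e i] acts as the identity on the isotypic component of ['chi_i] and as 0
    on the others, so its trace, multiplicity times degree, is its rank. *)
Lemma cfdot_irr_rank n (rG : mx_representation algC G n) (i : Iirr G) :
  '[cfRepr rG, 'chi_i] * 'chi_i 1%g = (\rank (gring_op rG (e i)))%:R.
Proof.
have memR : ((e i) \in group_ring algC G)%MS.
  by have := Wedderburn_id_mem (socle_of_Iirr i); rewrite genmxE mem_sub_gring => /andP[].
rewrite -mxtrace_idempotent; last first.
  rewrite -gring_opM //; congr (gring_op _ _).
  have [_ _ h _] := Wedderburn_is_id_pchar (algC'G_pchar G) (socle_of_Iirr i).
  by apply: h; exact: Wedderburn_id_mem.
rewrite -xcfun_repr [in RHS](cfun_sum_cfdot (cfRepr rG)).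
rewrite -[RHS]/(xcfun_r (e i) _) raddf_sum /= (bigD1 i) //= big1 ?addr0 => [|j ji].
  by rewrite xcfunZl xcfun_id eqxx.
by rewrite xcfunZl xcfun_id (negPf ji) mulr0.
Qed.

(* Multiplicities are ranks of the primitive central idempotents, which
   commute with intertwining maps. *)
Lemma cfdot_irr_subquotient m n N (rT : mx_representation algC G m)
    (rS : mx_representation algC G n) (rV : mx_representation algC G N)
    (A : 'M_(m, N)) (B : 'M_(n, N)) (i : Iirr G) :
    {in G, forall g, rT g *m A = A *m rV g} ->
    {in G, forall g, rS g *m B = B *m rV g} ->
    row_free A -> (A <= B)%MS ->
  '[cfRepr rT, 'chi_i] <= '[cfRepr rS, 'chi_i].
Proof.
move=> comA comB freeA leAB.
rewrite -(ler_pM2r (irr1_gt0 i)) !cfdot_irr_rank ler_nat.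
rewrite -(mxrankMfree _ freeA) (gring_op_intertwine _ comA).
apply: leq_trans (mxrankS (submxMr _ leAB)) _.
by rewrite -(gring_op_intertwine _ comB) mxrankM_maxl.
Qed.

Lemma submod_intertwine n (rG : mx_representation algC G n) U
    (modU : mxmodule rG U) :
  {in G, forall g, submod_repr modU g *m val_submod 1%:M
                   = val_submod 1%:M *m rG g}.
Proof.
move=> g Gg; rewrite -(val_submodE (submod_repr modU g)) /= /submod_mx.
by rewrite in_submodK // mxmodule_trans // val_submodP.
Qed.

Lemma val_submod_free n (U : 'M[algC]_n) : row_free (val_submod (1%:M : 'M_(\rank U))).
Proof. by rewrite /row_free val_submod1. Qed.

(** The projection factors through its image as [P = X *m V] with [V *m X = 1], and the trace is
    cyclic. *)
Lemma cfRepr_idempotent n (rG : mx_representation algC G n) (P : 'M_n)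
    (modP : mxmodule rG P) g :
  P *m P = P -> g \in G -> cfRepr (submod_repr modP) g = \tr (rG g *m P).
Proof.
move=> PP Gg; rewrite cfunE Gg mulr1n.
set V := val_submod (1%:M : 'M_(\rank P)).
set X := in_submod P P.
have XV : X *m V = P by rewrite -val_submodE in_submodK.
have VP : V *m P = V.
  have /submxP[D ->] : (V <= P)%MS by rewrite val_submodP.
  by rewrite -mulmxA PP.
have VX : V *m X = 1%:M.
  apply: (row_free_inj (val_submod_free P)).
  by rewrite /= -/V -mulmxA XV VP mul1mx.
have com : submod_repr modP g *m V = V *m rG g by exact: submod_intertwine.
by rewrite -[in RHS]XV mulmxA [RHS]mxtrace_mulC mulmxA -com -mulmxA VX mulmx1.
Qed.

End RepresentationRank.

(** * Left multiplication in the regular module *)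

Section RegularModule.

Variable gT : finGroupType.

Notation G := [set: gT]%G.
Notation rR := (regular_repr algC G).

Implicit Types (w : gT -> algC) (H : {group gT}).

Lemma sum_enum_val (F : gT -> algC) :
  \sum_(i < #|G|) F (enum_val i) = \sum_x F x.
Proof. by rewrite -(big_enum_val F); apply: eq_bigl => x; rewrite inE. Qed.

Definition gvec w : 'rV[algC]_#|G| := \row_j w (enum_val j).

(** The row of [g] is the product of [w] and [g] in the group algebra: this is left multiplication
    by [w], which commutes with the right regular action. *)
Definition lmul w : 'M[algC]_#|G| :=
  \matrix_i gvec (fun x => w (x * (enum_val i)^-1)%g).

Lemma eq_gvec w1 w2 : w1 =1 w2 -> gvec w1 = gvec w2.
Proof. by move=> eq_w; apply/rowP=> j; rewrite !mxE eq_w. Qed.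

Lemma delta_gvec g : delta_mx 0 (gring_index G g) = gvec (fun x => (x == g)%:R).
Proof.
apply/rowP=> j; rewrite !mxE eqxx /= -(inj_eq enum_val_inj) gring_indexK //.
Qed.

Lemma row_regular i g :
  row i (rR g) = gvec (fun x => (x == enum_val i * g)%:R)%g.
Proof. by rewrite rowK delta_gvec. Qed.

Lemma gvec_lmul w1 w2 :
  gvec w1 *m lmul w2 = gvec (fun x => \sum_y w1 y * w2 (x * y^-1)%g).
Proof.
apply/rowP=> j; rewrite !mxE -sum_enum_val.
by apply: eq_bigr => i _; rewrite !mxE.
Qed.

Lemma gvec_regular w g : gvec w *m rR g = gvec (fun x => w (x * g^-1)%g).
Proof.
apply/rowP=> j; rewrite !mxE.
transitivity (\sum_y w y * (enum_val j == y * g)%g%:R).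
  rewrite -sum_enum_val; apply: eq_bigr => i _.
  by have /rowP/(_ j) := row_regular i g; rewrite !mxE => ->.
rewrite (bigD1 (enum_val j * g^-1)%g) //= mulgKV eqxx mulr1.
rewrite big1 ?addr0 // => y ne; case: eqP => [e|]; last by rewrite mulr0.
by rewrite e mulgK eqxx in ne.
Qed.

Lemma lmul_regular w g : lmul w *m rR g = rR g *m lmul w.
Proof.
apply/row_matrixP=> i; rewrite !row_mul rowK gvec_regular row_regular gvec_lmul.
apply: eq_gvec => x; rewrite (bigD1 (enum_val i * g)%g) //= eqxx mul1r big1.
  by rewrite addr0 invMg mulgA.
by move=> y /negPf->; rewrite mul0r.
Qed.

Lemma lmul_module w : mxmodule rR (lmul w).
Proof. by apply/mxmoduleP=> g _; rewrite lmul_regular submxMl. Qed.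

Lemma gvec_sub_lmul w : (gvec w <= lmul w)%MS.
Proof.
suff <- : row (gring_index G 1%g) (lmul w) = gvec w by rewrite row_sub.
by rewrite rowK; apply: eq_gvec => x; rewrite gring_indexK ?group1 // invg1 mulg1.
Qed.

(** The map sends [h] to the product of [w], [h] and [g], whose coefficient at [h] is the value of
    [w] at a conjugate of [g^-1]. *)
Lemma trace_regular_lmul w g :
  \tr (rR g *m lmul w) = \sum_x w ((g^-1) ^ x)%g.
Proof.
rewrite (reindex_inj invg_inj) -sum_enum_val; apply: eq_bigr => i _.
have /rowP/(_ i) : row i (rR g *m lmul w) =
    gvec (fun x => w (x * (enum_val i * g)^-1)%g).
  by rewrite -lmul_regular row_mul rowK gvec_regular; apply: eq_gvec => x; rewrite invMg mulgA.
by rewrite !mxE => ->; rewrite conjgE invgK invMg mulgA.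
Qed.

Section LinearWeight.

Variable e : gT -> bool.
Hypothesis eM : {morph e : x y / (x * y)%g >-> x (+) y}.

Lemma signhom1 : e 1%g = false.
Proof. by have := eM 1%g 1%g; rewrite mulg1; case: (e 1%g). Qed.

Lemma signhomV x : e x^-1%g = e x.
Proof. by have := eM x x^-1%g; rewrite mulgV signhom1; do 2!case: (e _). Qed.

Lemma signhomJ x y : e (x ^ y)%g = e x.
Proof. by rewrite conjgE !eM signhomV; do 2!case: (e _). Qed.

(** The idempotent of the group algebra attached to the linear character [(-1) ^+ e x] of [H];
    [xpred0] gives the trivial character and [odd_perm] the sign. *)
Definition lin_weight H x : algC := (x \in H)%:R * (-1) ^+ e x / #|H|%:R.

Lemma lmul_lin_weight_idem H :
  lmul (lin_weight H) *m lmul (lin_weight H) = lmul (lin_weight H).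
Proof.
apply/row_matrixP=> i; rewrite row_mul !rowK gvec_lmul; apply: eq_gvec => x.
rewrite (reindex_inj (mulIg (enum_val i))) /=.
(* Every [y] in [H] contributes the same term to the convolution, so the right-hand side is spread
   over [#|H|] equal summands. *)
set z := (x * _)%g; rewrite [RHS](_ : _ =
  \sum_(y in H) lin_weight H z / #|H|%:R); last first.
  by rewrite sumr_const -[RHS]mulr_natr divfK // pnatr_eq0 -lt0n cardG_gt0.
rewrite [RHS]big_mkcond; apply: eq_bigr => y _ /=; rewrite mulgK invMg mulgA -/z.
rewrite /lin_weight; case: ifP => yH; last by rewrite !mul0r.
rewrite groupMr ?groupV // eM signhomV signr_addb mul1r.
case: (e y); rewrite /= ?expr0 ?expr1; case: (z \in H); rewrite /=; ring.
Qed.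

(* The character induced from the linear character of H with sign e. *)
Definition lin_ind H : 'CF(G) :=
  cfRepr (submod_repr (lmul_module (lin_weight H))).

Lemma lin_indE H g : lin_ind H g = \sum_x lin_weight H (g ^ x)%g.
Proof.
rewrite cfRepr_idempotent ?inE ?lmul_lin_weight_idem // trace_regular_lmul.
by apply: eq_bigr => x _; rewrite /lin_weight conjVg groupV signhomV.
Qed.

End LinearWeight.

End RegularModule.

(** * Inner products of characters induced from linear characters *)

Section YoungGeneric.

Variable gT : finGroupType.

Notation G := [set: gT]%G.
Notation rR := (regular_repr algC G).

Lemma leq_cfdot_char (a b phi psi : 'CF(G)) :
    phi \is a character -> psi \is a character ->
    (forall i, '[phi, 'chi_i] <= '[a, 'chi_i]) ->
    (forall i, '[psi, 'chi_i] <= '[b, 'chi_i]) ->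
  '[phi, psi] <= '[a, b].
Proof.
move=> Cphi Cpsi le_a le_b; rewrite !cfdot_sum_irr.
apply: ler_sum => i _.
have psi0 : 0 <= '[psi, 'chi_i] by rewrite natr_ge0 // Cnat_cfdot_char_irr.
have phi0 : 0 <= '[phi, 'chi_i] by rewrite natr_ge0 // Cnat_cfdot_char_irr.
rewrite [_^*]geC0_conj // [X in _ <= _ * X]geC0_conj; last exact: le_trans (le_b i).
exact: ler_pM.
Qed.

Variables (e1 e2 : gT -> bool).
Hypothesis e1M : {morph e1 : x y / (x * y)%g >-> x (+) y}.
Hypothesis e2M : {morph e2 : x y / (x * y)%g >-> x (+) y}.
Variables (H1 H2 : {group gT}).

Lemma cfdot_lin_ind :
  '[lin_ind e1 H1, lin_ind e2 H2] = (#|H1|%:R * #|H2|%:R)^-1 *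
    \sum_y \sum_(x in H1) (x ^ y \in H2)%g%:R * (-1) ^+ (e1 x (+) e2 x).
Proof.
rewrite cfdotE.
transitivity (#|G|%:R^-1 * \sum_(y : gT) \sum_(z : gT) \sum_(x : gT)
    lin_weight e1 H1 x * lin_weight e2 H2 (x ^ z)%g).
  congr (_ * _); transitivity (\sum_(x : gT) \sum_(y : gT) \sum_(z : gT)
      lin_weight e1 H1 (x ^ y)%g * lin_weight e2 H2 (x ^ z)%g).
    apply: eq_big => x; rewrite ?in_setT // !lin_indE // mulr_suml => _.
    apply: eq_bigr => y _; rewrite rmorph_sum mulr_sumr; apply: eq_bigr => z _.
    by congr (_ * _); rewrite /lin_weight !(rmorphM, fmorphV, rmorph_nat, rmorph_sign).
  (* Replacing [z] by [y * z] and then [x ^ y] by [x] makes the summand independent of [y], so the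
     outer sum only contributes a factor [#|G|]. *)
  rewrite exchange_big; apply: eq_bigr => y _.
  rewrite exchange_big [LHS](reindex_inj (mulgI y)); apply: eq_bigr => z _ /=.
  rewrite [RHS](reindex_inj (conjg_inj y)); apply: eq_bigr => x _.
  by rewrite conjgM.
rewrite sumr_const; set S := \sum_(z : gT) _; rewrite -[X in _ * X]mulr_natl mulrA -cardsT.
rewrite mulVf ?pnatr_eq0 -?lt0n ?cardG_gt0 // mul1r /S mulr_sumr.
apply: eq_bigr => y _; rewrite mulr_sumr [RHS]big_mkcond; apply: eq_bigr => x _.
rewrite /lin_weight signhomJ // signr_addb invfM.
by case: (x \in H1); rewrite /=; ring.
Qed.

End YoungGeneric.

(** * Young symmetrizers for a pair of subgroups *)

Section YoungModule.

Variable gT : finGroupType.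

Notation G := [set: gT]%G.
Notation rR := (regular_repr algC G).

Variable e : gT -> bool.
Hypothesis eM : {morph e : x y / (x * y)%g >-> x (+) y}.

(** Left multiplication by [t] permutes the terms and reverses their signs. *)
Lemma odd_sum0 (R C : {group gT}) y t :
    t \in R -> (t ^ y)%g \in C -> e t ->
  \sum_(x in R) (x ^ y \in C)%g%:R * (-1) ^+ (xpred0 x (+) e x) = 0 :> algC.
Proof.
move=> tR tC et; set S := \sum_(x in R) _.
suff SN : S = - S by apply/eqP; rewrite -[_ == 0](mulrn_eq0 S 2) mulr2n {1}SN addNr.
rewrite {1}/S (reindex_inj (mulgI t)) /S -sumrN; apply: eq_big => x.
  by rewrite groupMl.
by rewrite conjMg (groupMl _ tC) eM et /= signrN mulrN.
Qed.

Lemma lin_ind_orthogonal (R C : {group gT}) :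
    (forall y, exists t, [/\ t \in R, (t ^ y)%g \in C & e t]) ->
  '[lin_ind xpred0 R, lin_ind e C] = 0.
Proof.
move=> odd_elt; rewrite cfdot_lin_ind // big1 ?mulr0 // => y _.
by have [t [tR tC et]] := odd_elt y; apply: odd_sum0 tC et.
Qed.

Variables R C : {group gT}.
Hypothesis tiRC : R :&: C = 1%g.

(** Each [y] in [R * C] contributes 1, through [x = 1] alone, and every other [y] contributes 0; as
    [R] and [C] meet trivially, the size of [R * C] cancels the factor in front. *)
Lemma lin_ind_cfdot1 :
    (forall y, y \in (R * C)%g \/ exists t, [/\ t \in R, (t ^ y)%g \in C & e t]) ->
  '[lin_ind xpred0 R, lin_ind e C] = 1.
Proof.
move=> dich; rewrite cfdot_lin_ind // [X in _ * X](_ : _ = #|(R * C)%g|%:R).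
  rewrite TI_cardMg // natrM mulVf // mulf_neq0 // pnatr_eq0 -lt0n cardG_gt0 //.
rewrite -sumr_const [RHS]big_mkcond; apply: eq_bigr => y _.
have [yRC|nyRC] := ifPn.
  have /mulsgP[p q pR qC ->] := yRC.
  rewrite (bigD1 1%g) //= conj1g group1 signhom1 // mul1r big1 ?addr0 // => x.
  (* With [y = p * q] and [q] in [C], the condition becomes [x ^ p \in C], while [x ^ p] also lies
     in [R]. *)
  case/andP=> xR xn1; rewrite conjgM groupJr //.
  rewrite (_ : (x ^ p \in C)%g = false) ?mul0r //.
  apply: contraNF xn1 => xpC.
  have : (x ^ p)%g \in R :&: C by rewrite inE xpC groupJ.
  by rewrite tiRC inE conjg_eq1.
have [yRC|[t [tR tC et]]] := dich y; first by rewrite yRC in nyRC.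
exact: odd_sum0 tC et.
Qed.

(** At the row and column groups of [la] this is convertible to [young_symmetrizer la]. *)
Definition young_vec : 'rV[algC]_#|G| :=
  \sum_(p in R) \sum_(q in C)
    (-1) ^+ e q *: delta_mx 0 (gring_index G (p * q)%g).

Lemma young_vecE :
  young_vec = gvec (fun x => \sum_(q in C | (x * q^-1)%g \in R) (-1) ^+ e q).
Proof.
rewrite /young_vec exchange_big /=; apply/rowP=> j; rewrite summxE mxE.
rewrite big_mkcondr; apply: eq_bigr => q _; rewrite summxE.
under eq_bigr do rewrite delta_gvec !mxE.
rewrite -mulr_sumr; set x := enum_val j; case: ifP => xR.
  rewrite (bigD1 (x * q^-1)%g) //= mulgKV eqxx big1 ?addr0 ?mulr1 // => p /andP[_ ne].
  by case: eqP => // def_x; rewrite def_x mulgK eqxx in ne.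
rewrite big1 ?mulr0 // => p pR; case: eqP => // def_x.
by rewrite def_x mulgK pR in xR.
Qed.

(** Up to a scalar the Young vector is the product of the two idempotents, which ties it to both
    induced modules. *)
Lemma young_vec_lmul :
  young_vec = (#|R|%:R * #|C|%:R)
    *: (gvec (lin_weight e C) *m lmul (lin_weight xpred0 R)).
Proof.
rewrite young_vecE gvec_lmul; apply/rowP=> j; rewrite !mxE.
set x := enum_val j; rewrite mulr_sumr [LHS]big_mkcond; apply: eq_bigr => q _.
have cR : #|R|%:R != 0 :> algC by rewrite pnatr_eq0 -lt0n cardG_gt0.
have cC : #|C|%:R != 0 :> algC by rewrite pnatr_eq0 -lt0n cardG_gt0.
rewrite /lin_weight; case: (q \in C); case: (_ \in R); rewrite /= ?(mul0r, mulr0) //.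
by field; rewrite cC cR.
Qed.

Lemma young_vec_neq0 : young_vec != 0.
Proof.
apply/eqP=> /rowP/(_ (gring_index G 1%g)); rewrite young_vecE !mxE.
rewrite gring_indexK ?group1 // (big_pred1 1%g) => [|q].
  by rewrite signhom1 // expr0 => /eqP; rewrite oner_eq0.
by have /setP/(_ q) := tiRC; rewrite mul1g groupV !inE andbC.
Qed.

Definition young_char : 'CF(G) :=
  cfRepr (submod_repr (cyclic_mx_module rR young_vec)).

Lemma young_char_le_row i :
  '[young_char, 'chi_i] <= '[lin_ind xpred0 R, 'chi_i].
Proof.
apply: (cfdot_irr_subquotient i
  (submod_intertwine (cyclic_mx_module rR young_vec))
  (submod_intertwine (lmul_module (lin_weight xpred0 R)))).
  exact: val_submod_free.
rewrite !val_submod1 cyclic_mx_sub ?lmul_module // young_vec_lmul.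
by rewrite scalemx_sub // submxMl.
Qed.

(** Left multiplication by the row idempotent is an intertwining map, and it carries the column
    module onto a module containing the Young vector. *)
Lemma young_char_le_col i :
  '[young_char, 'chi_i] <= '[lin_ind e C, 'chi_i].
Proof.
set B := val_submod (1%:M : 'M_(\rank (lmul (lin_weight e C)))).
apply: (cfdot_irr_subquotient i (B := B *m lmul (lin_weight xpred0 R))
  (submod_intertwine (cyclic_mx_module rR young_vec))) => [g Gg||].
- by rewrite mulmxA submod_intertwine // -!mulmxA lmul_regular.
- exact: val_submod_free.
have eqB : (B *m lmul (lin_weight xpred0 R) :=:
            lmul (lin_weight e C) *m lmul (lin_weight xpred0 R))%MS.
  exact: eqmxMr (val_submod1 _).
rewrite val_submod1 eqB cyclic_mx_sub //.
  apply/mxmoduleP=> g _; rewrite -mulmxA lmul_regular mulmxA lmul_regular.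
  by rewrite -mulmxA submxMl.
by rewrite young_vec_lmul scalemx_sub // submxMr ?gvec_sub_lmul.
Qed.

(** The two multiplicity bounds give norm at most ['[lin_ind xpred0 R, lin_ind e C] = 1], and the
    norm is a nonzero natural number. *)
Lemma young_char_irr :
    (forall y, y \in (R * C)%g \/ exists t, [/\ t \in R, (t ^ y)%g \in C & e t]) ->
  young_char \in irr G.
Proof.
move=> dich; rewrite irrEchar cfRepr_char /=.
have Cyc : young_char \is a character := cfRepr_char _.
have : '[young_char] <= 1.
  rewrite -(lin_ind_cfdot1 dich).
  exact: (leq_cfdot_char Cyc Cyc young_char_le_row young_char_le_col).
have nz : '[young_char] != 0.
  rewrite cfnorm_eq0; apply/eqP=> /cfunP/(_ 1%g); rewrite cfRepr1 cfunE.
  move/eqP; rewrite pnatr_eq0 mxrank_eq0 cyclic_mx_eq0.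
  by rewrite (negPf young_vec_neq0).
have /natrP[k def_k] : '[young_char] \in Num.nat by exact: Cnat_cfdot_char.
by rewrite def_k pnatr_eq0 (ler_nat _ k 1) pnatr_eq1 in nz *; case: k nz {def_k} => [|[]].
Qed.

End YoungModule.

(** * Tableaux *)

Section Tableau.

Local Open Scope nat_scope.

Lemma fiber_stab_group_set (T : finType) (K : eqType) (f : T -> K) :
  group_set [set s : {perm T} | [forall i, f (s i) == f i]].
Proof.
apply/group_setP; split=> [|s t]; rewrite !inE.
  by apply/forallP=> i; rewrite perm1.
move=> /forallP fs /forallP ft; apply/forallP=> i.
by rewrite permM (eqP (ft _)) (eqP (fs _)).
Qed.

Variable n : nat.
Implicit Types la mu : intpart n.

Definition row_group la : {group 'S_n} :=
  Group (fiber_stab_group_set (fun i : 'I_n => reshape_index la i)).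
Definition col_group la : {group 'S_n} :=
  Group (fiber_stab_group_set (fun i : 'I_n => reshape_offset la i)).

Lemma sumn_intpart la : sumn la = n.
Proof. by case: la => s /= /and3P[_ _ /eqP]. Qed.

Lemma nth_intpart_le la i j : i <= j -> nth 0 la j <= nth 0 la i.
Proof.
move=> le_ij; have [lt_j|le_j] := ltnP j (size la); last by rewrite nth_default.
have Hs : sorted geq la by case: la {lt_j} => s /= /and3P[].
have trg : transitive geq by move=> a b c /= ba cb; apply: leq_trans cb ba.
have reg : reflexive geq by move=> a /=.
apply: (sorted_leq_nth trg reg 0 Hs) => //; rewrite inE //.
exact: leq_ltn_trans lt_j.
Qed.

(** Parts are nonzero, so the default value 0 of [nth] also reveals the length. *)
Lemma intpart_eq la mu : (forall i, nth 0 la i = nth 0 mu i) -> la = mu.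
Proof.
have le_size (la' mu' : intpart n) :
    (forall i, nth 0 la' i = nth 0 mu' i) -> size la' <= size mu'.
  move=> eq_nth; rewrite leqNgt; apply/negP=> lt_size.
  have : 0%N \in (la' : seq nat).
    by rewrite -[0%N](nth_default 0 (leqnn (size mu'))) -eq_nth mem_nth.
  by case: (la') => s /= /and3P[_ /negPf ->].
move=> eq_nth; apply: val_inj; apply: (@eq_from_nth _ 0) => [|i _] //.
by apply/eqP; rewrite eqn_leq !le_size.
Qed.

(** Dominance compares these numbers. In the canonical tableau the labels below [psum la k] fill
    exactly the rows before row [k]. *)
Definition psum la k := \sum_(i < k) nth 0 la i.

Lemma psumS la k : psum la k.+1 = psum la k + nth 0 la k.
Proof. by rewrite /psum big_ord_recr. Qed.

Lemma leq_psum la j k : j <= k -> psum la j <= psum la k.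
Proof.
move=> /subnK <-; elim: (k - j) => // d IH.
by rewrite addSn psumS (leq_trans IH) ?leq_addr.
Qed.

Lemma sumn_take la k : sumn (take k la) = psum la k.
Proof.
rewrite /psum; elim: k (la : seq nat) => [|k IH] s; first by rewrite big_ord0 take0.
rewrite big_ord_recl; case: s => [|x s] /=; last by rewrite IH.
by rewrite big1 // => i _; rewrite nth_nil.
Qed.

Lemma flatten_index_psum la r c : flatten_index la r c = psum la r + c.
Proof. by rewrite /flatten_index sumn_take. Qed.

Lemma psum_le la k : psum la k <= n.
Proof.
by rewrite -sumn_take -[X in _ <= X](sumn_intpart la) -{2}(cat_take_drop k la)
  sumn_cat leq_addr.
Qed.

Lemma offset_lt la (i : 'I_n) :
  reshape_offset la i < nth 0 la (reshape_index la i).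
Proof. by rewrite reshape_offsetP // sumn_intpart. Qed.

Lemma row_lt la (i : 'I_n) k : (reshape_index la i < k) = (i < psum la k).
Proof.
have def_i := reshape_indexK la i; rewrite flatten_index_psum in def_i.
have [lt_k|le_k] := ltnP.
  apply/esym; apply: leq_trans (leq_psum la lt_k).
  by rewrite psumS -[X in X < _]def_i ltn_add2l offset_lt.
apply/esym/negbTE; rewrite -leqNgt (leq_trans (leq_psum la le_k)) //.
by rewrite -[X in _ <= X]def_i leq_addr.
Qed.

Lemma box_inj la (i j : 'I_n) :
    reshape_index la i = reshape_index la j ->
    reshape_offset la i = reshape_offset la j -> i = j.
Proof.
move=> er ec; apply: val_inj => /=.
by rewrite -(reshape_indexK la i) er ec reshape_indexK.
Qed.

Lemma box_exists la r c : c < nth 0 la r ->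
  exists j : 'I_n, reshape_index la j = r /\ reshape_offset la j = c.
Proof.
move=> lt_c; have lt_n : flatten_index la r c < n.
  by rewrite -[X in _ < X](sumn_intpart la) flatten_indexP.
by exists (Ordinal lt_n); rewrite /= flatten_indexKl ?flatten_indexKr.
Qed.

Lemma row_col_TI la : row_group la :&: col_group la = 1%g.
Proof.
apply/trivgP/subsetP=> s; rewrite !inE => /andP[/forallP sr /forallP sc].
apply/eqP/permP=> i; rewrite perm1.
by apply: (box_inj (eqP (sr i)) (eqP (sc i))).
Qed.

Lemma card_row_lt la k : #|[set i : 'I_n | reshape_index la i < k]| = psum la k.
Proof.
have -> : [set i : 'I_n | reshape_index la i < k] = [set i : 'I_n | i < psum la k].
  by apply/setP=> i; rewrite !inE row_lt.
have inj_w : injective (widen_ord (psum_le la k)).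
  by move=> i j /(congr1 val) /= /val_inj.
rewrite -[RHS]card_ord -(card_imset _ inj_w).
apply: eq_card => i; rewrite inE; apply/idP/imsetP=> [lt_i|[j _ ->]] //=.
by exists (Ordinal lt_i) => //; apply: val_inj.
Qed.

Lemma card_fibers (A : {set 'I_n}) (f : 'I_n -> 'I_n) :
  #|A| = \sum_c #|[set i in A | f i == c]|.
Proof.
rewrite -sum1_card (partition_big f predT) //=; apply: eq_bigr => c _.
by rewrite sum1_card; apply: eq_card => i; rewrite !inE.
Qed.

Section Separated.

(* y separates rows from columns: boxes in one row of la go to distinct
   columns of mu. *)
Variables (la mu : intpart n) (y : 'S_n).
Hypothesis sep : forall i j : 'I_n, i != j ->
  reshape_index la i = reshape_index la j ->
  reshape_offset mu (y i) != reshape_offset mu (y j).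

Lemma offset_ltn (j : 'I_n) : reshape_offset mu j < n.
Proof.
by apply: leq_ltn_trans (ltn_ord j); apply: leq_subr.
Qed.

Lemma leq_col_count k (c : nat) :
  #|[set i : 'I_n | reshape_index la i < k & reshape_offset mu (y i) == c]| <=
  #|[set j : 'I_n | reshape_index mu j < k & reshape_offset mu j == c]|.
Proof.
case: k => [|k]; first by rewrite (eq_card0 (fun i => in_set _ _ : _ = false)).
have [lt_c|le_c] := ltnP c (nth 0 mu k).
  (* If column [c] of [mu] reaches row [k], each [i] is sent to the box of [mu] in column [c] and in
     the row of [i]; separation makes this injective. *)
  pose g (i : 'I_n) := odflt i [pick j : 'I_n | (reshape_index mu j == reshape_index la i)
                                      && (reshape_offset mu j == c)].
  have gP (i : 'I_n) : reshape_index la i < k.+1 ->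
      reshape_index mu (g i) = reshape_index la i /\ reshape_offset mu (g i) = c.
    move=> lt_i; rewrite /g; case: pickP => /= [j /andP[/eqP-> /eqP->] // | no_j].
    have [j [ej1 ej2]] := box_exists (leq_trans lt_c (nth_intpart_le mu (lt_i : _ <= k))).
    by have := no_j j; rewrite ej1 ej2 !eqxx.
  rewrite -(card_in_imset (f := g)) => [|i j]; last first.
    rewrite !inE => /andP[lt_i /eqP ci] /andP[lt_j /eqP cj] eq_g.
    have [ri _] := gP i lt_i; have [rj _] := gP j lt_j.
    apply/eqP/negPn/negP => ne_ij.
    have same_row : reshape_index la i = reshape_index la j by rewrite -ri -rj eq_g.
    by have := sep ne_ij same_row; rewrite ci cj eqxx.
  apply/subset_leq_card/subsetP=> _ /imsetP[i iA ->]; move: iA; rewrite !inE => /andP[lt_i _].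
  by have [-> ->] := gP i lt_i; rewrite lt_i eqxx.
(* Otherwise column [c] of [mu] ends before row [k], the row condition on the right is automatic,
   and [y] itself is the injection. *)
rewrite -(card_imset _ (@perm_inj _ y)).
apply/subset_leq_card/subsetP=> _ /imsetP[i iA ->]; move: iA; rewrite !inE => /andP[_ /eqP ci].
rewrite ci eqxx andbT ltnS leqNgt; apply/negP=> lt_k.
have := offset_lt mu (y i); rewrite ci ltnNge; case/negP.
by apply: leq_trans le_c; apply: nth_intpart_le; apply: ltnW.
Qed.

Lemma psum_col_count k : psum la k = \sum_(c < n)
  #|[set i : 'I_n | reshape_index la i < k & reshape_offset mu (y i) == c]|.
Proof.
rewrite -card_row_lt (card_fibers _ (fun i => Ordinal (offset_ltn (y i)))).
by apply: eq_bigr => c _; apply: eq_card => i; rewrite !inE -val_eqE.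
Qed.

Lemma psum_col_count_id k : psum mu k = \sum_(c < n)
  #|[set j : 'I_n | reshape_index mu j < k & reshape_offset mu j == c]|.
Proof.
rewrite -card_row_lt (card_fibers _ (fun i => Ordinal (offset_ltn i))).
by apply: eq_bigr => c _; apply: eq_card => i; rewrite !inE -val_eqE.
Qed.

Lemma separated_dominance k : psum la k <= psum mu k.
Proof.
rewrite psum_col_count psum_col_count_id; apply: leq_sum => c _.
exact: leq_col_count.
Qed.

End Separated.

End Tableau.

(** * Irreducibility and distinctness of the Specht characters *)

Section SpechtIrreducible.

Variable n : nat.
Implicit Types la mu : intpart n.

(** For equal shapes the column-wise inequalities behind dominance have equal sums, so each is an
    equality. *)
Lemma separated_offset_lt la (y : 'S_n) :
    (forall i j : 'I_n, i != j ->
      reshape_index la i = reshape_index la j ->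
      reshape_offset la (y i) != reshape_offset la (y j)) ->
  forall i : 'I_n, (reshape_offset la (y i) < nth 0 la (reshape_index la i))%N.
Proof.
move=> sep i; set k := reshape_index la i; set c := reshape_offset la (y i).
pose A k := [set i : 'I_n | reshape_index la i < k & reshape_offset la (y i) == c]%N.
pose B k := [set j : 'I_n | reshape_index la j < k & reshape_offset la j == c]%N.
have cn : (c < n)%N by apply: offset_ltn.
have eqAB k' : #|A k'| = #|B k'|.
  have := psum_col_count_id la k'; rewrite (psum_col_count la la y k').
  rewrite (bigD1 (Ordinal cn)) // [in RHS](bigD1 (Ordinal cn)) //= => eq_sum.
  apply/eqP; rewrite eqn_leq leq_col_count //= -(leq_add2r (\sum_(c' < n | c' != Ordinal cn)
    #|[set i : 'I_n | reshape_index la i < k' & reshape_offset la (y i) == c']%N|)).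
  rewrite [X in (_ <= X)%N]eq_sum leq_add2l.
  by apply: leq_sum => c' _; apply: leq_col_count.
(* The entry [i] is counted for [k.+1] but not for [k], so column [c] of [la] has a box in row
   [k]. *)
have : (#|B k| < #|B k.+1|)%N.
  rewrite -!eqAB; apply: proper_card; apply/properP; split.
    by apply/subsetP=> j; rewrite !inE ltnS => /andP[/ltnW-> ->].
  by exists i; rewrite !inE ?ltnn ?ltnSn ?eqxx.
rewrite ltnNge => /(contra (@subset_leq_card _ _ _)) /subsetPn[j].
rewrite !inE ltnS => /andP[le_j /eqP def_c]; rewrite def_c eqxx andbT -leqNgt => ge_j.
have -> : k = reshape_index la j by apply/eqP; rewrite eqn_leq ge_j le_j.
by rewrite -def_c offset_lt.
Qed.

Lemma odd_transposition la mu (y : 'S_n) (i j : 'I_n) : i != j ->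
    reshape_index la i = reshape_index la j ->
    reshape_offset mu (y i) = reshape_offset mu (y j) ->
  exists t : 'S_n, [/\ t \in row_group la, (t ^ y)%g \in col_group mu & odd_perm t].
Proof.
move=> ne_ij er ec; exists (tperm i j); split; last by rewrite odd_tperm.
  rewrite inE; apply/forallP=> k; case: tpermP => [->|->|_ _] //; exact/eqP.
rewrite tpermJ inE; apply/forallP=> k; case: tpermP => [->|->|_ _] //; exact/eqP.
Qed.

Lemma odd_or_separated la mu (y : 'S_n) :
  (exists t : 'S_n,
     [/\ t \in row_group la, (t ^ y)%g \in col_group mu & odd_perm t]) \/
  (forall i j : 'I_n, i != j -> reshape_index la i = reshape_index la j ->
     reshape_offset mu (y i) != reshape_offset mu (y j)).
Proof.
have [|sep] := boolP [exists i : 'I_n, exists j : 'I_n, [&& i != j,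
    reshape_index la i == reshape_index la j &
    reshape_offset mu (y i) == reshape_offset mu (y j)]].
  by case/existsP=> i /existsP[j /and3P[ne_ij /eqP er /eqP ec]];
    left; exact: odd_transposition er ec.
right=> i j ne_ij er; apply: contra sep => ec; apply/existsP; exists i.
by apply/existsP; exists j; rewrite ne_ij er eqxx.
Qed.

(** For a separating [y], moving [i] along its row to the column of [y i] defines [p] in the row
    group, and [p^-1 * y] preserves columns. *)
Lemma row_col_dichotomy la (y : 'S_n) :
  y \in (row_group la * col_group la)%g \/
  exists t : 'S_n, [/\ t \in row_group la, (t ^ y)%g \in col_group la & odd_perm t].
Proof.
have [|sepP] := odd_or_separated la la y; first by right.
left; have lt_off := separated_offset_lt sepP.
pose g (i : 'I_n) := odflt i [pick j : 'I_n | (reshape_index la j == reshape_index la i)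
                                      && (reshape_offset la j == reshape_offset la (y i))].
have gP (i : 'I_n) : reshape_index la (g i) = reshape_index la i /\
                     reshape_offset la (g i) = reshape_offset la (y i).
  rewrite /g; case: pickP => /= [j /andP[/eqP-> /eqP->] // | no_j].
  have [j [ej1 ej2]] := box_exists (lt_off i).
  by have := no_j j; rewrite ej1 ej2 !eqxx.
have inj_g : injective g.
  move=> i j eq_g; apply/eqP/negPn/negP => ne_ij.
  have [[ri ci] [rj cj]] := (gP i, gP j).
  have er : reshape_index la i = reshape_index la j by rewrite -ri -rj eq_g.
  by have := sepP i j ne_ij er; rewrite -ci -cj eq_g eqxx.
pose p := perm inj_g; apply/mulsgP; exists p (p^-1 * y)%g; last by rewrite mulKVg.
  by rewrite inE; apply/forallP=> i; rewrite permE; have [-> _] := gP i.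
rewrite inE; apply/forallP=> i; rewrite permM.
by have [_ <-] := gP (p^-1%g i); rewrite -(permE inj_g) permKV.
Qed.

Lemma odd_permMb : {morph @odd_perm 'I_n : x y / (x * y)%g >-> x (+) y}.
Proof. exact: odd_permM. Qed.

Lemma chi_young la :
  chi la = young_char (@odd_perm 'I_n) (row_group la) (col_group la).
Proof. by []. Qed.

Lemma chi_irr la : chi la \in irr [set: 'S_n].
Proof.
rewrite chi_young; apply: young_char_irr => //.
- exact: odd_permMb.
- exact: row_col_TI.
- exact: row_col_dichotomy.
Qed.

Lemma chi_char la : chi la \is a character.
Proof. exact: cfRepr_char. Qed.

(** A separating [y] would make [mu] dominate [la]; hence every [y] admits an odd element and the
    two induced characters are orthogonal. *)
Lemma chi_orthogonal_dom la mu k :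
  (psum mu k < psum la k)%N -> '[chi la, chi mu] = 0.
Proof.
move=> lt_psum; apply/eqP; rewrite eq_le; apply/andP; split; last first.
  by rewrite natr_ge0 // Cnat_cfdot_char ?chi_char.
rewrite -(lin_ind_orthogonal odd_permMb (R := row_group la) (C := col_group mu)).
  apply: leq_cfdot_char => [||i|i]; try exact: chi_char.
    by rewrite (chi_young la); exact: young_char_le_row.
  by rewrite (chi_young mu); exact: young_char_le_col.
move=> y; have [//|sep] := odd_or_separated la mu y.
by have := separated_dominance sep k; rewrite leqNgt lt_psum.
Qed.

Lemma chi_inj : injective (@chi n).
Proof.
move=> la mu eq_chi.
have nz : '[chi la, chi mu] != 0 by rewrite -eq_chi (irrWnorm (chi_irr la)) oner_eq0.
have nz' : '[chi mu, chi la] != 0 by rewrite eq_chi (irrWnorm (chi_irr mu)) oner_eq0.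
have eq_psum k : psum la k = psum mu k.
  apply/eqP; rewrite eqn_leq; apply/andP; split; rewrite leqNgt; apply/negP => lt_k.
    by move: nz; rewrite (chi_orthogonal_dom lt_k) eqxx.
  by move: nz'; rewrite (chi_orthogonal_dom lt_k) eqxx.
apply: intpart_eq => k; apply/eqP.
by rewrite -(eqn_add2l (psum la k)) -psumS [X in (X + nth 0 mu k)%N]eq_psum -psumS eq_psum.
Qed.

End SpechtIrreducible.

(** * Restriction to the stabiliser of the last point *)

Section LiftPerm.

Variable n : nat.

Lemma lift_perm_exists (i j : 'I_n.+1) (s : 'S_n.+1) :
  s i = j -> exists s', s = lift_perm i j s'.
Proof.
move=> sij.
pose f k := odflt k (unlift j (s (lift i k))).
have fP k : lift j (f k) = s (lift i k).
  rewrite /f; case: unliftP => [k' -> //|] /eqP.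
  by rewrite -sij (inj_eq perm_inj) eq_sym (negPf (neq_lift _ _)).
have inj_f : injective f.
  by move=> k l eq_f; apply: (@lift_inj _ i); apply: (@perm_inj _ s); rewrite -!fP eq_f.
exists (perm inj_f); apply/permP=> k.
have [k' ->|->] := unliftP i k; last by rewrite lift_perm_id.
by rewrite lift_perm_lift permE fP.
Qed.

Lemma lift_perm_inj (i j : 'I_n.+1) : injective (lift_perm i j).
Proof.
move=> s t eq_st; apply/permP=> k; apply: (@lift_inj _ j).
by rewrite -!(lift_perm_lift i) eq_st.
Qed.

Lemma lift_perm_imset (i j : 'I_n.+1) :
  [set s : 'S_n.+1 | s i == j] = lift_perm i j @: [set: 'S_n].
Proof.
apply/setP=> s; rewrite inE; apply/eqP/imsetP => [/lift_perm_exists[s' ->]|[s' _ ->]].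
  by exists s'; rewrite ?inE.
exact: lift_perm_id.
Qed.

Lemma sum_lift_perm (i j : 'I_n.+1) (F : 'S_n.+1 -> algC) :
  \sum_(s : 'S_n.+1 | s i == j) F s = \sum_s F (lift_perm i j s).
Proof.
transitivity (\sum_(s in [set s : 'S_n.+1 | s i == j]) F s).
  by apply: eq_bigl => s; rewrite inE.
rewrite lift_perm_imset big_imset /=; last by move=> s t _ _; apply: lift_perm_inj.
by apply: eq_bigl => s; rewrite inE.
Qed.

End LiftPerm.

(** * Smaller Specht modules inside a restricted one *)

Section Branching.

Variable n : nat.

Definition up (s : 'S_n) : 'S_n.+1 := lift_perm ord_max ord_max s.

Lemma upM : {in [set: 'S_n] &, {morph up : s t / (s * t)%g}}.
Proof. by move=> s t _ _; rewrite /up lift_permM. Qed.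

Canonical up_morphism := Morphism upM.

Lemma up_mx_repr m (rG : mx_representation algC [set: 'S_n.+1]%G m) :
  mx_repr [set: 'S_n]%G (fun s => rG (up s)).
Proof.
split=> [|s t sG tG]; first by rewrite /up lift_perm1 repr_mx1.
by rewrite upM // repr_mxM ?inE.
Qed.

Definition up_repr m rG := MxRepresentation (@up_mx_repr m rG).

Variables (la : intpart n.+1) (mu : intpart n) (r : nat).
Hypothesis la_mu : forall k, nth 0%N la k = (nth 0%N mu k + (k == r))%N.

Lemma psum_add_box k : psum la k = (psum mu k + (r < k))%N.
Proof.
elim: k => [|k IH]; first by rewrite /psum !big_ord0.
by rewrite !psumS IH la_mu ltnS; case: ltngtP; lia.
Qed.

(** The new box ends row [r] of [la], so the labels before it are those of rows 0 to [r] of [mu]. *)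
Lemma removed_box_lt : (psum mu r.+1 < n.+1)%N.
Proof. by rewrite ltnS psum_le. Qed.

(* The label, in the canonical tableau of shape la, of the box la - mu. *)
Definition removed_box : 'I_n.+1 := Ordinal removed_box_lt.

(** Skipping the label of the removed box identifies the canonical tableau of [mu] with that of [la]
    without this box. *)
Lemma lift_removed_boxE (i : 'I_n) : lift removed_box i =
  flatten_index la (reshape_index mu i) (reshape_offset mu i) :> nat.
Proof.
rewrite flatten_index_psum psum_add_box /= /bump /=.
rewrite leqNgt -row_lt ltnS -ltnNge addnAC -flatten_index_psum reshape_indexK.
by rewrite addnC.
Qed.

Lemma offset_lt_add_box (i : 'I_n) :
  (reshape_offset mu i < nth 0%N la (reshape_index mu i))%N.
Proof. by rewrite la_mu (leq_trans (offset_lt mu i)) ?leq_addr. Qed.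

Lemma lift_removed_box_index (i : 'I_n) :
  reshape_index la (lift removed_box i) = reshape_index mu i.
Proof. by rewrite lift_removed_boxE flatten_indexKl ?offset_lt_add_box. Qed.

Lemma lift_removed_box_offset (i : 'I_n) :
  reshape_offset la (lift removed_box i) = reshape_offset mu i.
Proof. by rewrite lift_removed_boxE flatten_indexKr ?offset_lt_add_box. Qed.

Lemma lift_perm_row_group s :
  (lift_perm removed_box removed_box s \in row_group la) = (s \in row_group mu).
Proof.
rewrite !inE; apply/forallP/forallP => h i.
  by have := h (lift removed_box i); rewrite lift_perm_lift !lift_removed_box_index.
have [k ->|->] := unliftP removed_box i; last by rewrite lift_perm_id.
by rewrite lift_perm_lift !lift_removed_box_index.
Qed.

Lemma lift_perm_col_group s :
  (lift_perm removed_box removed_box s \in col_group la) = (s \in col_group mu).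
Proof.
rewrite !inE; apply/forallP/forallP => h i.
  by have := h (lift removed_box i); rewrite lift_perm_lift !lift_removed_box_offset.
have [k ->|->] := unliftP removed_box i; last by rewrite lift_perm_id.
by rewrite lift_perm_lift !lift_removed_box_offset.
Qed.

(* Only the terms of the Young symmetrizer of la that fix the removed box
   survive, and they make up the Young symmetrizer of mu. *)
Lemma young_coef_lift (x : 'S_n) (z := lift_perm removed_box removed_box x) :
  \sum_(q in col_group la | (z * q^-1)%g \in row_group la) (-1) ^+ odd_perm q =
  \sum_(q in col_group mu | (x * q^-1)%g \in row_group mu) (-1) ^+ odd_perm q
    :> algC.
Proof.
pose A := [set q in col_group mu | (x * q^-1)%g \in row_group mu].
transitivity (\sum_(q in lift_perm removed_box removed_box @: A)
    (-1) ^+ odd_perm q : algC); last first.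
  rewrite big_imset /=; last by move=> s t _ _; apply: lift_perm_inj.
  apply: eq_big => q; first by rewrite inE.
  by rewrite odd_lift_perm addbb.
apply: eq_bigl => q; apply/andP/imsetP => [[qC zqR]|[q' + ->]]; last first.
  rewrite inE => /andP[qC xqR]; rewrite lift_perm_col_group qC.
  by rewrite lift_permV lift_permM lift_perm_row_group xqR.
(* Since [z] fixes the box and [z * q^-1] keeps it in its row, [q^-1] keeps it in its row; it also
   keeps it in its column. *)
have qVbox : q^-1%g removed_box = removed_box.
  apply: (@box_inj _ la).
    move: zqR; rewrite inE => /forallP/(_ removed_box)/eqP.
    by rewrite permM lift_perm_id.
  have : (q^-1)%g \in col_group la by rewrite groupV.
  by rewrite inE => /forallP/(_ removed_box)/eqP.
have qbox : q removed_box = removed_box by rewrite -{1}qVbox permKV.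
have [q' def_q] := lift_perm_exists qbox; exists q' => //.
move: qC zqR; rewrite def_q lift_perm_col_group lift_permV lift_permM.
by rewrite lift_perm_row_group [q' \in A]inE => -> ->.
Qed.

Notation RegS m := (regular_repr algC [set: 'S_m]%G).

(* Keeps the permutations placing n (the last point) in the removed box. *)
Definition drop_last : 'M[algC]_(#|[set: 'S_n.+1]%G|, #|[set: 'S_n]%G|) :=
  \matrix_i gvec (fun x => (enum_val i == lift_perm removed_box ord_max x)%:R).

Lemma gvec_drop_last w :
  gvec w *m drop_last = gvec (fun x => w (lift_perm removed_box ord_max x)).
Proof.
apply/rowP=> j; rewrite !mxE; set z := lift_perm _ _ _.
transitivity (\sum_y w y * (y == z)%:R).
  by rewrite -sum_enum_val; apply: eq_bigr => i _; rewrite !mxE.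
rewrite (bigD1 z) //= eqxx mulr1 big1 ?addr0 // => y /negPf->.
by rewrite mulr0.
Qed.

Lemma drop_last_regular g :
  RegS n.+1 (up g) *m drop_last = drop_last *m RegS n g.
Proof.
apply/row_matrixP=> i; rewrite !row_mul row_regular gvec_drop_last rowK.
rewrite gvec_regular; apply: eq_gvec => x; congr (_%:R).
rewrite -(inj_eq (mulIg (up g)) _ (lift_perm _ _ _)) /up lift_permM mulgKV.
by rewrite eq_sym.
Qed.

(** The translation turns permutations fixing the removed box into those sending it to the last
    point, which [drop_last] keeps. *)
Lemma young_symmetrizer_drop_last : young_symmetrizer mu =
  young_symmetrizer la *m RegS n.+1 (lift_perm removed_box ord_max 1)
    *m drop_last.
Proof.
rewrite -[young_symmetrizer mu]/(young_vec (@odd_perm _) (row_group mu) (col_group mu)).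
rewrite -[young_symmetrizer la]/(young_vec (@odd_perm _) (row_group la) (col_group la)).
rewrite !young_vecE gvec_regular gvec_drop_last; apply: eq_gvec => x.
by rewrite lift_permV lift_permM invg1 mulg1 young_coef_lift.
Qed.

(** The image of the Specht module of [la] under the intertwining map [drop_last] contains the Young
    symmetrizer of [mu]. *)
Lemma branching_le i :
  '[chi mu, 'chi_i] <= '[cfRepr (up_repr (specht_repr la)), 'chi_i].
Proof.
set V := val_submod (1%:M : 'M_(\rank (specht_mx la))).
have com g : g \in [set: 'S_n]%G ->
    up_repr (specht_repr la) g *m (V *m drop_last) = V *m drop_last *m RegS n g.
  move=> _; rewrite -(mulmxA V) -drop_last_regular (mulmxA V) (mulmxA (up_repr _ g) V).
  congr (_ *m _).
  exact: (submod_intertwine (cyclic_mx_module _ _) (in_setT (up g))).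
apply: (cfdot_irr_subquotient i (B := V *m drop_last)
  (submod_intertwine (cyclic_mx_module (RegS n) (young_symmetrizer mu)))) => //.
  exact: val_submod_free.
have eqV : (V *m drop_last :=: specht_mx la *m drop_last)%MS.
  exact: eqmxMr (val_submod1 _).
rewrite val_submod1 eqV cyclic_mx_sub //.
  apply/mxmoduleP=> g _; rewrite -mulmxA -drop_last_regular mulmxA submxMr //.
  by apply: (mxmoduleP (cyclic_mx_module _ _)); rewrite inE.
rewrite young_symmetrizer_drop_last submxMr //.
by rewrite mxmodule_trans ?cyclic_mx_module ?cyclic_mx_id ?inE.
Qed.

End Branching.

(** * Fixed points, restriction and induction *)

Section InductionRestriction.

Variable n : nat.

Notation Sn := [set: 'S_n]%G.
Notation SnS := [set: 'S_n.+1]%G.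
Notation upG := ((@up_morphism n) @* [set: 'S_n])%G.

(** Summing over points first, each point stabiliser is conjugate to that of the last point. *)
Lemma sum_fix_class_fun (F : 'S_n.+1 -> algC) :
    (forall x y, F (x ^ y)%g = F x) ->
  \sum_(x : 'S_n.+1) #|[set i : 'I_n.+1 | x i == i]|%:R * F x
  = n.+1%:R * \sum_(s : 'S_n) F (up s).
Proof.
move=> FJ; transitivity (\sum_(i : 'I_n.+1) \sum_(x : 'S_n.+1 | x i == i) F x).
  rewrite (exchange_big_dep xpredT) //=; apply: eq_bigr => x _.
  rewrite sumr_const -[RHS]mulr_natl; congr (_%:R * _).
  by apply: eq_card => i; rewrite inE.
rewrite (eq_bigr (fun=> \sum_(s : 'S_n) F (up s))) => [|i _].
  by rewrite sumr_const card_ord mulr_natl.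
rewrite sum_lift_perm; apply: eq_bigr => s _.
rewrite -(FJ _ (lift_perm i ord_max 1)); congr F.
by rewrite conjgE lift_permV !lift_permM invg1 mul1g mulg1.
Qed.

Lemma up_isom : isom Sn upG (@up_morphism n).
Proof.
by apply/isomP; split=> //; apply/injmP => s t _ _; apply: lift_perm_inj.
Qed.

Definition res (phi : 'CF(SnS)) : 'CF(Sn) := cfMorph ('Res[upG] phi).
Definition ind (psi : 'CF(Sn)) : 'CF(SnS) := 'Ind[SnS] (cfIsom up_isom psi).

Lemma resE phi s : res phi s = phi (up s).
Proof.
rewrite cfMorphE ?inE // cfResE ?subsetT //.
by apply: mem_morphim; rewrite inE.
Qed.

Lemma cfdot_ind psi phi : '[ind psi, phi] = '[psi, res phi].
Proof.
rewrite -Frobenius_reciprocity -(cfIsom_iso up_isom psi); congr '[_, _].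
apply/cfun_inP=> _ /morphimP[s _ sG ->].
by rewrite cfIsomE ?inE // resE cfResE ?subsetT // mem_morphim.
Qed.

Lemma card_fix_up (s : 'S_n) :
  #|[set i : 'I_n.+1 | up s i == i]| = #|[set i : 'I_n | s i == i]|.+1.
Proof.
have -> : [set i : 'I_n.+1 | up s i == i]
    = ord_max |: (lift ord_max @: [set i : 'I_n | s i == i]).
  apply/setP=> i; rewrite !inE; have [k ->|->] := unliftP ord_max i; last first.
    by rewrite /up lift_perm_id !eqxx.
  rewrite /up lift_perm_lift (inj_eq (@lift_inj _ _)) eq_sym (mem_imset _ _ (@lift_inj _ _)).
  by rewrite inE [lift _ _ == ord_max]eq_sym (negPf (neq_lift _ _)) eq_sym.
rewrite cardsU1 card_imset; last exact: lift_inj.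
rewrite (_ : ord_max \notin _) //; apply/imsetP=> [[k _ /eqP]].
by rewrite (negPf (neq_lift _ _)).
Qed.

(** One term of the induction formula: [cfIsom up_isom psi] vanishes off the stabiliser of the last
    point. *)
Lemma cfIsom_up_conj psi (s t : 'S_n) (i : 'I_n.+1) :
  cfIsom up_isom psi (up s ^ lift_perm i ord_max t)%g = (up s i == i)%:R * psi s.
Proof.
have upI z : up z \in upG by apply: mem_morphim; rewrite inE.
set a := up s; set y := lift_perm i ord_max t.
have [fix_i|nfix_i] := eqVneq (a i) i; last first.
  rewrite mul0r cfun0 //; apply: contra nfix_i => /morphimP[z _ _] /= def_z.
  have : (a ^ y)%g ord_max = ord_max by rewrite def_z /= /up lift_perm_id.
  have <- : y i = ord_max by exact: lift_perm_id.
  by rewrite permJ => /perm_inj ->.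
(* The transposition of the fixed points i and n commutes with a. *)
have aJ : (a ^ tperm i ord_max)%g = a.
  have: (tperm i ord_max ^ a)%g = tperm i ord_max.
    by rewrite tpermJ fix_i /a /up lift_perm_id.
  by move=> tJ; rewrite conjgE -{2}tJ -conjgC mulKg.
have /lift_perm_exists[z def_z] : (tperm i ord_max * y)%g ord_max = ord_max.
  by rewrite permM tpermR lift_perm_id.
rewrite mul1r -{1}aJ -conjgM def_z -/(up z) /a.
rewrite -(morphJ (@up_morphism n)) ?inE // cfIsomE ?inE // cfunJ ?inE //.
Qed.

(** The terms of the induction formula are grouped by the point [i] that [y] sends to the last one;
    the fixed points of [up s] are those of [s] and the last point. *)
Lemma res_indE psi s :
  res (ind psi) s = (#|[set i : 'I_n | s i == i]|.+1)%:R * psi s.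
Proof.
rewrite resE cfIndE ?subsetT // -(isom_card up_isom).
rewrite (eq_bigl xpredT) => [|y]; last by rewrite inE.
rewrite (partition_big (fun y : 'S_n.+1 => y^-1%g ord_max) predT) //=.
transitivity (#|Sn|%:R^-1 *
    \sum_(i : 'I_n.+1) (up s i == i)%:R * psi s * #|Sn|%:R).
  congr (_ * _); apply: eq_bigr => i _.
  rewrite (eq_bigl (fun y : 'S_n.+1 => y i == ord_max)) => [|y]; last first.
    by rewrite (canF_eq (permKV y)) eq_sym.
  rewrite sum_lift_perm (eq_bigr (fun=> (up s i == i)%:R * psi s)) => [|t _].
    by rewrite sumr_const -[LHS]mulr_natr cardsT.
  exact: cfIsom_up_conj.
rewrite -mulr_suml mulrC mulfK ?neq0CG // -mulr_suml; congr (_ * _).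
rewrite -card_fix_up -sum1_card natr_sum [RHS]big_mkcond /=; apply: eq_bigr => i _.
by rewrite inE; case: eqP.
Qed.

Lemma cfnorm_ind psi : '[ind psi] =
  '[psi] + #|Sn|%:R^-1 *
    \sum_(s : 'S_n) #|[set i : 'I_n | s i == i]|%:R * (psi s * (psi s)^*).
Proof.
rewrite cfdot_ind !cfdotE -mulrDr; congr (_ * _).
rewrite [X in _ = _ + X](eq_bigl (fun s => s \in Sn)) => [|s]; last by rewrite inE.
rewrite -big_split; apply: eq_bigr => s _ /=; rewrite res_indE.
rewrite -[_.+1]addn1 natrD rmorphM rmorphD /= !rmorph_nat; ring.
Qed.

Lemma cfnorm_res (phi : 'CF(SnS)) : '[res phi] =
  #|SnS|%:R^-1 *
    \sum_(x : 'S_n.+1) #|[set i : 'I_n.+1 | x i == i]|%:R * (phi x * (phi x)^*).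
Proof.
rewrite sum_fix_class_fun => [|x y]; last by rewrite cfunJ ?inE.
rewrite cfdotE !cardsT !card_Sn factS natrM invfM mulrACA mulVf ?pnatr_eq0 // mul1r.
rewrite (eq_bigl xpredT) => [|s]; last by rewrite inE.
by congr (_ * _); apply: eq_bigr => s _; rewrite resE.
Qed.

End InductionRestriction.

(** * Adding and removing boxes *)

Section BoxRemoval.

Local Open Scope nat_scope.

(** The values are cut off at the first zero, because parts must be nonzero. *)
Lemma intpart_of_fun n (f : nat -> nat) K :
    (forall i, f i.+1 <= f i) -> f K = 0 -> \sum_(i < K) f i = n ->
  exists la : intpart n, forall i, nth 0 la i = f i.
Proof.
move=> f_dec fK0 sum_f.
have f_le i j : i <= j -> f j <= f i.
  by move/subnK <-; elim: (j - i) => // d IH; rewrite addSn (leq_trans (f_dec _)).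
have ex0 : exists m, f m == 0 by exists K; rewrite fK0.
case: (ex_minnP ex0) => m /eqP fm0 min_m.
have le_mK : m <= K by apply: min_m; rewrite fK0.
have f0 i : m <= i -> f i = 0.
  by move=> le_mi; apply/eqP; rewrite -leqn0 -fm0 f_le.
have part_f : is_intpart n (mkseq f m).
  apply/and3P; split.
  - apply: (path_sorted (x := f 0)); case: m {min_m fm0 le_mK f0} => // m.
    rewrite /mkseq /= leqnn /= path_map.
    elim: m 0 => //= m IH i; rewrite f_dec; exact: IH.
  - apply/negP=> /mapP[i]; rewrite mem_iota /= => lt_i /esym/eqP/min_m.
    by rewrite leqNgt lt_i.
  - apply/eqP; rewrite -sum_f sumnE big_map -{1}(subn0 m) big_mkord.
    rewrite -(subnKC le_mK) big_split_ord /= [X in _ + X]big1 ?addn0 // => i _.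
    by rewrite f0 // leq_addr.
exists (IntPart part_f) => i /=.
have [lt_i|le_i] := ltnP i m; first by rewrite nth_mkseq.
by rewrite nth_default ?size_mkseq // f0.
Qed.

Definition add_box n (la : intpart n.+1) (mu : intpart n) (r : nat) :=
  forall k, nth 0 la k = nth 0 mu k + (k == r).

Definition corners n (la : intpart n) : seq nat :=
  [seq r <- iota 0 (size la) | nth 0 la r.+1 < nth 0 la r].

Lemma cornersP n (la : intpart n) r :
  (r \in corners la) = (nth 0 la r.+1 < nth 0 la r).
Proof.
rewrite mem_filter mem_iota /= add0n andbC.
have [//|le_r] := ltnP r (size la).
by rewrite (nth_default 0 le_r) (nth_default 0 (leqW le_r)).
Qed.

Lemma nth_intpart_gt0 n (la : intpart n) r : (0 < nth 0 la r) = (r < size la).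
Proof.
have [lt_r|le_r] := ltnP r (size la); last by rewrite nth_default.
rewrite lt0n; apply/negP=> /eqP r0.
have : 0 \in (la : seq nat) by rewrite -r0 mem_nth.
by case: (la) => s /= /and3P[_ /negPf ->].
Qed.

Lemma psum_size n (la : intpart n) k : size la <= k -> psum la k = n.
Proof. by move=> le_k; rewrite -sumn_take take_oversize ?sumn_intpart. Qed.

Lemma add_box_corner n (la : intpart n.+1) (mu : intpart n) r :
  add_box la mu r -> r \in corners la.
Proof.
move=> la_mu; rewrite cornersP !la_mu eqxx (gtn_eqF (ltnSn r)) addn0 addn1 ltnS.
exact: nth_intpart_le.
Qed.

Lemma corner_remove n (la : intpart n.+1) r :
  r \in corners la -> exists mu : intpart n, add_box la mu r.
Proof.
rewrite cornersP => lt_r; pose K := (maxn r.+1 (size la)).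
have r_gt0 : 0 < nth 0 la r by apply: leq_ltn_trans lt_r.
have la_k k : nth 0 la k = nth 0 la k - (k == r) + (k == r).
  by case: eqP => [->|_]; rewrite ?subnK ?subn0 ?addn0.
case: (@intpart_of_fun n (fun k => nth 0 la k - (k == r)) K) => [k|||mu mu_k].
- have [->|_] := eqVneq k r; first by rewrite (gtn_eqF (ltnSn r)) subn0 /=; lia.
  by rewrite subn0 (leq_trans (leq_subr _ _)) // nth_intpart_le.
- by rewrite nth_default // leq_maxr.
- have : psum la K = n.+1 by rewrite psum_size // leq_maxr.
  rewrite /psum (eq_bigr _ (fun (k : 'I_K) _ => la_k k)) big_split /= addnC.
  have rK : r < K by rewrite leq_maxl.
  rewrite (bigD1 (Ordinal rK)) //= eqxx big1 => [|k]; first by lia.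
  by rewrite -val_eqE /= => /negPf ->.
by exists mu => k; rewrite mu_k -la_k.
Qed.

(** A box fits in row 0 always and in row [r.+1] exactly when [r] is a corner; hence one more
    addable box than removable ones. *)
Definition add_rows n (mu : intpart n) : seq nat := 0 :: map S (corners mu).

Lemma add_rowsP n (mu : intpart n) r :
  (r \in add_rows mu) = (r == 0) || (nth 0 mu r < nth 0 mu r.-1).
Proof.
rewrite inE; case: r => [|r] //=.
by rewrite (mem_map succn_inj) cornersP.
Qed.

Lemma add_box_row n (la : intpart n.+1) (mu : intpart n) r :
  add_box la mu r -> r \in add_rows mu.
Proof.
move=> la_mu; rewrite add_rowsP; case: r la_mu => //= r la_mu.
have := nth_intpart_le la (leqnSn r); rewrite !la_mu eqxx (ltn_eqF (ltnSn r)).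
by rewrite addn0 addn1.
Qed.

Lemma row_add n (mu : intpart n) r :
  r \in add_rows mu -> exists la : intpart n.+1, add_box la mu r.
Proof.
(* The new box may open a new row, so the bound must also exceed [r]. *)
rewrite add_rowsP => row_r; pose K := (maxn r.+1 (size mu)).
apply: (@intpart_of_fun n.+1 (fun k => nth 0 mu k + (k == r)) K) => [k||].
- have := nth_intpart_le mu (leqnSn k); case: (k.+1 =P r) row_r => [<-|_ _].
    by rewrite (ltn_eqF (ltnSn k)) /=; lia.
  by lia.
- by rewrite nth_default ?leq_maxr // gtn_eqF // leq_maxl.
have : psum mu K = n by rewrite psum_size // leq_maxr.
have rK : r < K by rewrite leq_maxl.
rewrite /psum big_split /= => ->; rewrite (bigD1 (Ordinal rK)) //= eqxx big1.
  by lia.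
by move=> k; rewrite -val_eqE /= => /negPf ->.
Qed.

Lemma add_box_row_inj n (la : intpart n.+1) (mu : intpart n) r r' :
  add_box la mu r -> add_box la mu r' -> r = r'.
Proof.
move=> h h'; have := h r; rewrite h' eqxx => /addnI.
by case: eqP.
Qed.

(** Rows and partitions determine each other, so counting partitions reduces to counting rows. *)
Lemma seq_of_witnesses (T : eqType) (s : seq nat) (P : nat -> T -> Prop) :
    uniq s -> (forall r, r \in s -> exists x, P r x) ->
    (forall r r' x, P r x -> P r' x -> r = r') ->
    (forall r x x', P r x -> P r x' -> x = x') ->
  exists l : seq T, [/\ uniq l, size l = size s &
    forall x, x \in l <-> exists2 r, r \in s & P r x].
Proof.
move=> + + Pinj Pfun; elim: s => [|r s IH] /=.
  by move=> _ _; exists [::]; split=> // x; split=> // -[].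
case/andP=> r_s uniq_s exP.
have [|l [uniq_l size_l lP]] := IH uniq_s.
  by move=> r' r's; apply: exP; rewrite inE r's orbT.
have [x Px] := exP r (mem_head _ _); exists (x :: l); split=> /=.
- rewrite uniq_l andbT; apply: contra r_s => /lP[r' r's Pr'].
  by rewrite (Pinj _ _ _ Px Pr').
- by rewrite size_l.
move=> y; rewrite inE; split=> [/orP[/eqP->|/lP[r' r's Pr']]|[r']].
- by exists r; rewrite ?mem_head.
- by exists r'; rewrite // inE r's orbT.
rewrite inE => /orP[/eqP-> /Pfun-/(_ _ Px)->|r's Pr']; first by rewrite eqxx.
by apply/orP; right; apply/lP; exists r'.
Qed.

Lemma removed_parts n (la : intpart n.+1) :
  exists l : seq (intpart n), [/\ uniq l, size l = size (corners la) &
    forall mu, mu \in l <-> exists r, add_box la mu r].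
Proof.
have [||||l [Ul Sl lP]] := @seq_of_witnesses _ (corners la) (fun r mu => add_box la mu r).
- by rewrite filter_uniq ?iota_uniq.
- by move=> r; apply: corner_remove.
- by move=> r r' mu; apply: add_box_row_inj.
- move=> r mu mu' h h'; apply: intpart_eq => k.
  by apply: (@addIn (k == r)); rewrite -h -h'.
exists l; split=> // mu; split=> [/lP[r _ h]|[r h]]; first by exists r.
by apply/lP; exists r; rewrite // (add_box_corner h).
Qed.

Lemma added_parts n (mu : intpart n) :
  exists l : seq (intpart n.+1), [/\ uniq l, size l = (size (corners mu)).+1 &
    forall la, la \in l <-> exists r, add_box la mu r].
Proof.
have [||||l [Ul Sl lP]] := @seq_of_witnesses _ (add_rows mu) (fun r la => add_box la mu r).
- rewrite /add_rows cons_uniq (map_inj_uniq succn_inj) filter_uniq ?iota_uniq // andbT.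
  by apply/mapP=> [[]].
- by move=> r; apply: row_add.
- by move=> r r' la; apply: add_box_row_inj.
- by move=> r la la' h h'; apply: intpart_eq => k; rewrite h h'.
exists l; split=> //; first by rewrite Sl /= size_map.
move=> la; split=> [/lP[r _ h]|[r h]]; first by exists r.
by apply/lP; exists r; rewrite // (add_box_row h).
Qed.

Lemma removes_boxP n (la : intpart n.+1) (mu : intpart n) :
  removes_box la mu <-> exists r, add_box la mu r.
Proof.
split=> [[r lt_r h]|[r h]]; exists r.
- move=> k; have hk c := h (k, c); rewrite /ferrers /= in hk.
  have la_r : 0 < nth 0 la r by rewrite nth_intpart_gt0.
  have [eq_k|ne_k] := eqVneq k r; last first.
    have {}hk c : (c < nth 0 mu k) = (c < nth 0 la k).
      by rewrite hk xpair_eqE (negPf ne_k) andbT.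
    (* Testing the equivalence at both row lengths forces them to agree. *)
    have := hk (nth 0 mu k); have := hk (nth 0 la k); rewrite !ltnn.
    by case: ltngtP; lia.
  rewrite {}eq_k in hk *.
  have {}hk c : (c < nth 0 mu r) = (c < (nth 0 la r).-1).
    by rewrite hk xpair_eqE eqxx /=; case: eqP; lia.
  have := hk (nth 0 mu r); have := hk (nth 0 la r).-1; rewrite !ltnn; lia.
- by rewrite -nth_intpart_gt0 h eqxx addn1.
move=> [k c]; rewrite /ferrers /= !h eqxx addn1 /= xpair_eqE.
by case: eqP => [->|_]; rewrite ?addn0 ?andbT //; lia.
Qed.

End BoxRemoval.

(** * The branching rule *)

Section BranchingRule.

Lemma chi_cfdot n (la mu : intpart n) : '[chi la, chi mu] = (la == mu)%:R.
Proof.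
have [i def_i] := irrP (chi_irr la); have [j def_j] := irrP (chi_irr mu).
rewrite -(inj_eq (@chi_inj n)) def_i def_j cfdot_irr.
by rewrite (inj_eq irr_inj).
Qed.

Lemma cfdot_sum_chi n (l : seq (intpart n)) (mu : intpart n) : uniq l ->
  '[\sum_(la <- l) chi la, chi mu] = (mu \in l)%:R.
Proof.
move=> Ul; rewrite cfdot_suml; have [mul|nmul] := boolP (mu \in l).
  rewrite (bigD1_seq mu) //= chi_cfdot eqxx big1 ?addr0 // => la /negPf ne.
  by rewrite chi_cfdot ne.
rewrite big_seq big1 // => la lal; rewrite chi_cfdot.
by case: eqP => // e; rewrite -e lal in nmul.
Qed.

Lemma cfnorm_sum_chi n (l : seq (intpart n)) : uniq l ->
  '[\sum_(la <- l) chi la] = (size l)%:R.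
Proof.
move=> Ul; rewrite cfdot_sumr big_seq (eq_bigr (fun=> 1)) => [|la lal].
  by rewrite -big_seq big_const_seq count_predT iter_addr_0.
by rewrite cfdot_sum_chi // lal.
Qed.

(** The inner product of [phi] with its product by the fixed-point character. In positive degree it
    is the norm of the restriction, but it also makes sense in degree 0, where the induction
    starts. *)
Definition fix_norm n (phi : 'CF([set: 'S_n])) : algC := #|[set: 'S_n]|%:R^-1 *
  \sum_(s : 'S_n) #|[set i : 'I_n | s i == i]|%:R * (phi s * (phi s)^*).

Lemma cfRepr_up_repr n (la : intpart n.+1) :
  cfRepr (up_repr (specht_repr la)) = res (chi la).
Proof. by apply/cfun_inP=> s sG; rewrite resE !cfunE !inE. Qed.

Lemma chi_res_ge1 n (la : intpart n.+1) (mu : intpart n) r :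
  add_box la mu r -> 1 <= '[res (chi la), chi mu].
Proof.
move=> la_mu; have [i def_i] := irrP (chi_irr mu).
rewrite -cfRepr_up_repr; have := branching_le la_mu i.
by rewrite -{1 2}def_i chi_cfdot eqxx.
Qed.

(* Each chi la occurs in the induced character, whose norm is the number of
   such la, so nothing else occurs. *)
Lemma ind_chi n (mu : intpart n) (l : seq (intpart n.+1)) :
    fix_norm (chi mu) = (size (corners mu))%:R ->
    uniq l -> size l = (size (corners mu)).+1 ->
    (forall la, la \in l <-> exists r, add_box la mu r) ->
  ind (chi mu) = \sum_(la <- l) chi la.
Proof.
move=> norm_mu Ul Sl lP; apply/eqP; rewrite -subr_eq0 -cfnorm_eq0 eq_le cfnorm_ge0 andbT.
(* With [c] corners both norms equal [c.+1], so an inner product of at least [c.+1] makes the norm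
   of the difference at most 0. *)
rewrite cfnormB cfnorm_ind -/(fix_norm (chi mu)) norm_mu chi_cfdot eqxx.
rewrite cfnorm_sum_chi // Sl.
have ge_l : (size l)%:R <= '[ind (chi mu), \sum_(la <- l) chi la].
  rewrite cfdot_sumr -sum1_size natr_sum big_seq [leRHS]big_seq.
  apply: ler_sum => la /lP[r la_mu]; have res_ge1 := chi_res_ge1 la_mu.
  by rewrite cfdot_ind cfdotC geC0_conj // (le_trans ler01).
rewrite (geC0_conj (le_trans (ler0n _ _) ge_l)); rewrite Sl in ge_l.
rewrite -[X in X - _](_ : (size (corners mu)).+1%:R + (size (corners mu)).+1%:R = _).
  by rewrite subr_le0 lerD.
by rewrite -natr1 /=; ring.
Qed.

Lemma cfun_irr_ext gT (G : {group gT}) (phi psi : 'CF(G)) :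
  (forall i, '[phi, 'chi_i] = '[psi, 'chi_i]) -> phi = psi.
Proof.
move=> eq_i; rewrite (cfun_sum_cfdot phi) (cfun_sum_cfdot psi).
by apply: eq_bigr => i _; rewrite eq_i.
Qed.

(** Frobenius reciprocity against each irreducible [chi mu] reduces this to the decomposition of
    [ind (chi mu)]. *)
Lemma res_chi_ind n (la : intpart n.+1) (l : seq (intpart n)) :
    (forall i : Iirr [set: 'S_n], exists mu : intpart n, 'chi_i = chi mu) ->
    (forall mu : intpart n, fix_norm (chi mu) = (size (corners mu))%:R) ->
    uniq l -> (forall mu, mu \in l <-> exists r, add_box la mu r) ->
  res (chi la) = \sum_(mu <- l) chi mu.
Proof.
move=> all_chi norm_chi Ul lP; apply: cfun_irr_ext => i.
have [mu ->] := all_chi i; rewrite cfdot_sum_chi //.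
have [l' [Ul' Sl' l'P]] := added_parts mu.
rewrite cfdotC -cfdot_ind (ind_chi _ Ul' Sl' l'P) // cfdot_sum_chi // rmorph_nat.
congr (nat_of_bool _)%:R; apply/idP/idP.
  by move/l'P/lP.
by move/lP/l'P.
Qed.

(** Both claims go through one induction: in degree [n] they give the decompositions of restrictions
    to and inductions from ['S_n], which yield both claims in degree [n.+1]. *)
Lemma chi_complete n :
  (forall i : Iirr [set: 'S_n], exists mu : intpart n, 'chi_i = chi mu) /\
  (forall mu : intpart n, fix_norm (chi mu) = (size (corners mu))%:R).
Proof.
elim: n => [|n [all_chi norm_chi]].
  have triv (s : 'S_0) : s = 1%g by apply/permP=> -[].
  split=> [i | mu]; last first.
    rewrite /fix_norm big1 ?mulr0 => [|s _]; last first.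
      by rewrite (_ : #|_| = 0%N) ?mul0r //; apply: eq_card0 => -[].
    case def_c: (corners mu) => [//|r c].
    have := mem_head r c; rewrite -def_c cornersP => lt_r.
    have := psum_le mu r.+1; rewrite psumS leqn0 addn_eq0 => /andP[_ /eqP r0].
    by rewrite r0 in lt_r.
  have [|mu _] := @intpart_of_fun 0 (fun=> 0%N) 0 (fun=> leqnn _) (erefl _).
    by rewrite big_ord0.
  exists mu; have abS : abelian [set: 'S_0].
    by apply/centsP=> s _ t _; rewrite (triv s) (triv t).
  have [j def_j] := irrP (chi_irr mu); rewrite def_j.
  by apply/cfunP=> s; rewrite (triv s) !lin_char1 //; apply/char_abelianP.
split=> [i | la]; last first.
  have [l [Ul Sl lP]] := removed_parts la.
  rewrite /fix_norm -cfnorm_res (res_chi_ind all_chi norm_chi Ul lP).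
  by rewrite cfnorm_sum_chi // Sl.
(* The restriction has some constituent [chi mu], so ['chi_i] occurs in [ind (chi mu)], a sum of
   Specht characters. *)
have nz : res 'chi_i != 0.
  apply/eqP=> /cfunP/(_ 1%g); rewrite resE cfunE /up lift_perm1.
  by apply/eqP; exact: irr1_neq0.
have [j] := neq0_has_constt nz; rewrite irr_consttE; have [mu ->] := all_chi j.
have [l [Ul Sl lP]] := added_parts mu.
rewrite cfdotC conjC_eq0 -cfdot_ind (ind_chi _ Ul Sl lP) // cfdot_suml => nz_sum.
have [/hasP[la _ /eqP <-]|/hasPn no_la] := boolP (has (fun la => chi la == 'chi_i) l).
  by exists la.
case/eqP: nz_sum; rewrite big_seq big1 // => la /no_la ne_la.
have [j' def_la] := irrP (chi_irr la); rewrite def_la cfdot_irr.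
by rewrite -(inj_eq irr_inj) -def_la (negPf ne_la).
Qed.

Lemma branching_rule n (la : intpart n.+1) (mus : seq (intpart n)) :
    uniq mus -> (forall mu, mu \in mus <-> removes_box la mu) ->
  res (chi la) = \sum_(mu <- mus) chi mu.
Proof.
have [all_chi norm_chi] := chi_complete n => Umus musP.
apply: (res_chi_ind all_chi norm_chi Umus) => mu.
by rewrite musP; apply: removes_boxP.
Qed.

End BranchingRule.

(** * From the branching rule to the eigenvalue recursion *)

Lemma sum_chi_fixing_set n (mu : intpart n) k :
  dimf mu * eta mu k = \sum_(s in fixing_set n k) chi mu s.
Proof.
rewrite /eta mulVKf // /dimf; have [i ->] := irrP (chi_irr mu).
exact: irr1_neq0.
Qed.

(* Both sides count the pairs of a permutation with exactly k fixed points and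
   one of its fixed points. *)
Lemma sum_fixing_set n k (phi : 'CF([set: 'S_n.+1])) : (0 < k)%N ->
  k%:R * \sum_(x in fixing_set n.+1 k) phi x =
  n.+1%:R * \sum_(s in fixing_set n k.-1) res phi s.
Proof.
move=> k_gt0; pose F (x : 'S_n.+1) := (x \in fixing_set n.+1 k)%:R * phi x.
transitivity (\sum_(x : 'S_n.+1) #|[set i : 'I_n.+1 | x i == i]|%:R * F x).
  rewrite mulr_sumr big_mkcond; apply: eq_bigr => x _; rewrite /F.
  rewrite inE; case: eqP => [->|_]; first by rewrite mul1r.
  by rewrite mul0r mulr0.
rewrite sum_fix_class_fun => [|x y].
  congr (_ * _); rewrite [RHS]big_mkcond; apply: eq_bigr => s _.
  (* [up s] fixes one point more than [s], so [k] becomes [k.-1], which needs [k] positive. *)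
  rewrite /F resE !inE card_fix_up -[in LHS](prednK k_gt0) eqSS.
  by case: eqP; rewrite ?mul1r ?mul0r.
(* [y] maps the fixed points of [x] onto those of [x ^ y], so [F] is a class function. *)
rewrite /F cfunJ ?inE //; congr ((nat_of_bool _)%:R * _).
congr (_ == _); rewrite -[RHS](card_imset _ (@perm_inj _ y)).
apply: eq_card => i; rewrite inE -[i](permKV y) permJ (mem_imset _ _ perm_inj).
by rewrite inE (inj_eq perm_inj).
Qed.

Theorem theorem3p7 (n k : nat) (hk0 : (0 < k)%N) (hkn : (k < n)%N)
    (la : intpart n) (mus : seq (intpart n.-1)) (mus_uniq : uniq mus)
    (musP : forall mu : intpart n.-1, mu \in mus <-> removes_box la mu) :
  eta la k =
    n%:R / (k%:R * dimf la) * \sum_(mu <- mus) dimf mu * eta mu k.-1.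
Proof.
case: n hkn la mus mus_uniq musP => // n _ la mus mus_uniq musP.
rewrite /eta; set S := \sum_(s in _) _.
have k_neq0 : k%:R != 0 :> algC by rewrite pnatr_eq0 -lt0n.
have -> : S = k%:R^-1 * (n.+1%:R * \sum_(mu <- mus) dimf mu * eta mu k.-1).
  apply: (canRL (mulKf k_neq0)); rewrite sum_fixing_set //; congr (_ * _).
  rewrite (branching_rule mus_uniq musP).
  under eq_bigr do rewrite sum_cfunE.
  rewrite exchange_big; apply: eq_bigr => mu _.
  by rewrite sum_chi_fixing_set.
by rewrite invfM; ring.
Qed.
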